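(* For the submodule $M=[(z-w)^2]$ of $H^2(\mathbb D^2)$, the sequence $\{\Sigma_k(M)\}_{k\ge0}$ is strictly decreasing, and as $k\to\infty$, \[ \Sigma_k(M)=\frac{92}{105k}+\frac{46}{105k^2}+O\!\left(\frac1{k^3}\right). \]
   Context: $H^2(\mathbb D^2)$ is the Hardy space on the bidisk (monomials $z^aw^b$ orthonormal); $[q]$ is the smallest closed subspace containing $q$ invariant under multiplication by $z$ and $w$. Let $p=(z-w)^2$. For $n\ge0$ let $A^n=(a_{i,j})_{i,j=0}^n$ with $a_{i,j}=\langle pw^{|i-j|},pz^{|i-j|}\rangle$ (the symmetric pentadiagonal Toeplitz matrix with diagonal $6$, first off-diagonals $-4$, second off-diagonals $1$); $D_0=1$, $D_n=\det A^{n-1}$ ($n\ge1$); $A^n_{i,j}$ is the $(i,j)$ cofactor of $A^n$. Define $\phi_0=\psi_0=p/\|p\|$ and for $n\ge1$ $\phi_n=\frac{\sum_{j=0}^n pA^n_{0,j}z^jw^{n-j}}{\sqrt{D_{n+1}D_n}}$, $\psi_n=\frac{\sum_{j=0}^n pA^n_{n,j}z^jw^{n-j}}{\sqrt{D_{n+1}D_n}}$, orthonormal bases of $M\ominus zM$ and $M\ominus wM$ for $M=[p]$. The numerical invariants are $\Sigma_k(M):=\sum_{n\ge0}|\langle w^k\phi_n,z^k\psi_n\rangle|^2$, $k\ge0$ (for $k=0,1$ these coincide with $\|[R_2^*,R_2][R_1^*,R_1]\|_{HS}^2$ and $\|[R_1^*,R_2]\|_{HS}^2$, $R_1,R_2$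 being multiplication by $z,w$ on $M$). *)

(* Defs.v *)
From HB Require Import structures.
From mathcomp Require Import all_boot all_order all_algebra.
From mathcomp Require Import all_classical all_reals all_analysis.
Set Implicit Arguments. Unset Strict Implicit. Unset Printing Implicit Defensive.
Import Order.TTheory GRing.Theory Num.Theory numFieldNormedType.Exports.
Local Open Scope ring_scope.

Section Hardy.
Variable R : realType.

(* Polynomials in two variables z, w with real coefficients, represented
   as polynomials in z whose coefficients are polynomials in w:
   the coefficient of z^a w^b in f is (f`_a)`_b. *)
Local Notation bipoly := {poly {poly R}}.

Definition zv : bipoly := 'X.
Definition wv : bipoly := ('X)%:P.

(* Inner product of H^2(D^2) restricted to polynomials (monomials z^a w^b
   orthonormal). For real coefficients no conjugation is needed. The sum over
   the support of f is exact, since all other terms vanish. *)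
Definition hip (f g : bipoly) : R :=
  \sum_(a < size f) \sum_(b < size (f`_a)) (f`_a)`_b * (g`_a)`_b.

Definition rsc (c : R) (f : bipoly) : bipoly := (c%:P)%:P * f.

Definition pp : bipoly := (zv - wv) ^+ 2.

(* A^{n-1} in the paper's notation: the n x n matrix
   (<p w^{|i-j|}, p z^{|i-j|}>)_{i,j}; so A^n = Amx n.+1. *)
Definition Amx (n : nat) : 'M[R]_n :=
  \matrix_(i < n, j < n) hip (pp * wv ^+ `|(i : int) - (j : int)|%N)
                             (pp * zv ^+ `|(i : int) - (j : int)|%N).

Definition Dn (n : nat) : R := \det (Amx n).

Definition phi (n : nat) : bipoly :=
  match n with
  | 0%N => rsc (Num.sqrt (hip pp pp))^-1 pp
  | n'.+1 =>
    rsc (Num.sqrt (Dn n.+1 * Dn n))^-1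
      (\sum_(j < n.+1)
        (rsc (cofactor (Amx n.+1) ord0 j) (pp * zv ^+ j * wv ^+ (n - j))))
  end.

Definition psi (n : nat) : bipoly :=
  match n with
  | 0%N => rsc (Num.sqrt (hip pp pp))^-1 pp
  | n'.+1 =>
    rsc (Num.sqrt (Dn n.+1 * Dn n))^-1
      (\sum_(j < n.+1)
        (rsc (cofactor (Amx n.+1) ord_max j) (pp * zv ^+ j * wv ^+ (n - j))))
  end.

Definition Sigma_term (k n : nat) : R :=
  `| hip (wv ^+ k * phi n) (zv ^+ k * psi n) | ^+ 2.

Definition Sigma (k : nat) : R := limn (series (Sigma_term k)).

End Hardy.

(* Main.v *)
Require Import Defs.
From HB Require Import structures.
From mathcomp Require Import all_boot all_order all_algebra.
From mathcomp Require Import all_classical all_reals all_analysis.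
From mathcomp Require Import zify ring lra.
Import Order.TTheory GRing.Theory Num.Theory numFieldNormedType.Exports.
Local Open Scope ring_scope.

(* The pentadiagonal Toeplitz matrix has an explicit first inverse column, cubic
   in the index, because fourth differences kill cubics; the adjugate then gives
   all the cofactors that are needed. With N = n + 2 the n-th term of Sigma_k is
   the square of
     2 (N+1-k) (3k(k-1) - (N-1)(N+2)) / ((N-1) N (N+1) (N+2))   if k <= N,
   and 0 otherwise. Expanding this square in partial fractions, everything
   telescopes except a multiple A(k) / N^2, so that
     Sigma_k = A(k) * (sum of 1/N^2 over N >= k) + R(k)   for k >= 2,
   with A and R polynomial in k. The tail of zeta(2) lies between two consecutive
   convergents of the Stieltjes continued fraction of the trigamma function at
   y = k - 1/2, and these are sharp enough both for the expansion and for the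
   monotonicity. *)

(** * Inner products of monomial multiples of p and the Toeplitz symbol *)

Section Hip.
Set Implicit Arguments. Unset Strict Implicit. Unset Printing Implicit Defensive.
Variable R : realType.
Implicit Types f g : {poly {poly R}}.

Lemma sum_ord_widen (V : nmodType) (F : nat -> V) (n m : nat) : (n <= m)%N ->
  (forall i, (n <= i)%N -> F i = 0) -> \sum_(i < n) F i = \sum_(i < m) F i.
Proof.
move=> nm F0; rewrite -!(big_mkord xpredT F) (big_cat_nat (leq0n n) nm) /=.
by rewrite [X in _ + X]big_nat_cond [X in _ + X]big1 ?addr0// => i /andP[/andP[+ _] _]; exact: F0.
Qed.

(** Padding the ranges adds only zero terms; common bounds let inner products with different left
    arguments be added term by term. *)
Lemma hipE (m l : nat) f g : (size f <= m)%N -> (forall a, (size (f`_a)%R <= l)%N) ->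
  hip f g = \sum_(a < m) \sum_(b < l) (f`_a)`_b * (g`_a)`_b.
Proof.
move=> fm fl; rewrite /hip.
under eq_bigr => a _.
  rewrite (@sum_ord_widen _ (fun b => (f`_a)`_b * (g`_a)`_b) _ l) //; last first.
    by move=> i ib; rewrite nth_default ?mul0r.
  over.
rewrite (@sum_ord_widen _ (fun a => \sum_(b < l) (f`_a)`_b * (g`_a)`_b) _ m) //.
by move=> i ia; rewrite big1// => b _; rewrite (nth_default _ ia) coef0 mul0r.
Qed.

Lemma bipoly_bound f : exists l, forall a, (size (f`_a)%R <= l)%N.
Proof.
exists (\max_(a < size f) size (f`_a)%R) => a.
have [ha|ha] := ltnP a (size f); last by rewrite nth_default// size_poly0.
exact: (leq_bigmax (Ordinal ha)).
Qed.

Lemma hipDl f1 f2 g : hip (f1 + f2) g = hip f1 g + hip f2 g.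
Proof.
have [l1 h1] := bipoly_bound f1; have [l2 h2] := bipoly_bound f2.
pose m := maxn (size f1) (size f2); pose l := maxn l1 l2.
rewrite !(@hipE m l) ?leq_maxl ?leq_maxr ?size_polyD//.
- rewrite -big_split; apply: eq_bigr => a _; rewrite -big_split; apply: eq_bigr => b _ /=.
  by rewrite !coefD mulrDl.
- by move=> a; rewrite (leq_trans (h2 a))// leq_maxr.
- by move=> a; rewrite (leq_trans (h1 a))// leq_maxl.
- move=> a; rewrite coefD (leq_trans (size_polyD _ _))// geq_max.
  by rewrite (leq_trans (h1 a)) ?leq_maxl// (leq_trans (h2 a))// leq_maxr.
Qed.

Lemma coef_rsc (c : R) f a b : ((rsc c f)`_a)`_b = c * (f`_a)`_b.
Proof. by rewrite /rsc !coefCM. Qed.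

Lemma hip_rscl (c : R) f g : hip (rsc c f) g = c * hip f g.
Proof.
have [l hl] := bipoly_bound f.
rewrite !(@hipE (size f) l)//.
- rewrite mulr_sumr; apply: eq_bigr => a _; rewrite mulr_sumr; apply: eq_bigr => b _.
  by rewrite coef_rsc mulrA.
- rewrite /rsc mul_polyC; exact: size_scale_leq.
- by move=> a; rewrite /rsc coefCM mul_polyC (leq_trans (size_scale_leq _ _)).
Qed.

Lemma hip0l g : hip 0 g = 0.
Proof. by rewrite /hip size_poly0 big_ord0. Qed.

Lemma hip_suml (I : finType) (F : I -> {poly {poly R}}) g :
  hip (\sum_i F i) g = \sum_i hip (F i) g.
Proof. by apply: (big_morph (fun f => hip f g)) => [f1 f2|]; [exact: hipDl|exact: hip0l]. Qed.

Lemma hip_rscr (c : R) f g : hip f (rsc c g) = c * hip f g.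
Proof.
rewrite /hip mulr_sumr; apply: eq_bigr => a _; rewrite mulr_sumr; apply: eq_bigr => b _.
by rewrite coef_rsc mulrCA.
Qed.

Lemma hip_sumr (I : finType) f (G : I -> {poly {poly R}}) :
  hip f (\sum_i G i) = \sum_i hip f (G i).
Proof.
rewrite /hip exchange_big; apply: eq_bigr => a _.
rewrite exchange_big; apply: eq_bigr => b _ /=.
by rewrite !coef_sum mulr_sumr.
Qed.

Local Notation mon a b := (zv R ^+ a * wv R ^+ b).

Lemma coef_mon a b c d : ((mon a b)`_c)`_d = ((c == a) && (d == b))%:R.
Proof.
rewrite /zv /wv -polyC_exp coefMC !coefXn.
by case: (c == a); rewrite ?mul1r ?mul0r ?coefXn ?coef0.
Qed.

Lemma hip_mon a b g : hip (mon a b) g = (g`_a)`_b.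
Proof.
rewrite (@hipE a.+1 b.+1).
- rewrite (bigD1 ord_max)//= (bigD1 ord_max)//= coef_mon !eqxx mul1r.
  rewrite !big1 ?addr0// => [i ia|i ib].
    by rewrite big1// => j _; rewrite coef_mon -(inj_eq val_inj)/= in ia *; rewrite (negPf ia) mul0r.
  by rewrite coef_mon eqxx/= -(inj_eq val_inj)/= in ib *; rewrite (negPf ib) mul0r.
- by apply/leq_sizeP => j hj; apply/polyP => d; rewrite coef_mon coef0; case: eqP => // ja; lia.
- by move=> c; apply/leq_sizeP => j hj; rewrite coef_mon; case: (c == a) => //=; case: eqP => // ja; lia.
Qed.

Lemma pp_mon i j :
  pp R * zv R ^+ i * wv R ^+ j = mon i.+2 j + rsc (- 2%:R) (mon i.+1 j.+1) + mon i j.+2.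
Proof.
rewrite /rsc /pp !rmorphN !rmorph_nat /=; rewrite !exprS; ring.
Qed.

(* The symbol of the Toeplitz matrix [Amx]. *)
Definition toep (a b : nat) : R :=
  (a == b)%:R *+ 6 - (a == b.+1)%:R *+ 4 - (a.+1 == b)%:R *+ 4
  + (a == b.+2)%:R + (a.+2 == b)%:R.

Lemma toepC a b : toep a b = toep b a.
Proof. by rewrite /toep ![b == _]eq_sym ![_ == a]eq_sym; ring. Qed.

Lemma toep_addl i a b : toep (i + a) (i + b) = toep a b.
Proof. by rewrite /toep -!addnS !eqn_add2l. Qed.

Lemma eqn_pair_sum a b c d : (a + b = c + d)%N -> (a == c) && (b == d) = (a == c).
Proof. by move=> e; apply/andb_idr => /eqP ac; apply/eqP; lia. Qed.

(** All monomials involved have total degree [i + j + 2], so equal z-exponents force equal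
    w-exponents and only [i], [i'] matter. The autocorrelation of (1, -2, 1) gives 6, -4, 1. *)
Lemma hip_pp i j i' j' : (i + j = i' + j')%N ->
  hip (pp R * zv R ^+ i * wv R ^+ j) (pp R * zv R ^+ i' * wv R ^+ j') = toep i i'.
Proof.
move=> e; rewrite !pp_mon !hipDl hip_rscl !hip_mon !coefD !coef_rsc !coef_mon /toep.
rewrite !(eqn_pair_sum, eqSS); [|lia..].
ring.
Qed.

Lemma AmxE n (i j : 'I_n) : Amx R n i j = toep i j.
Proof.
rewrite mxE; set d := `|_|%N.
have -> : toep i j = toep 0 d.
  have [ij|/ltnW ij] := leqP i j.
    by rewrite -[toep 0 d](toep_addl i) addn0; congr toep; rewrite /d; lia.
  by rewrite toepC -[toep 0 d](toep_addl j) addn0; congr toep; rewrite /d; lia.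
by have := @hip_pp 0 d d 0; rewrite !expr0 !mulr1 addn0; exact.
Qed.

Definition trunc m (F : nat -> R) (i : nat) := if (i < m)%N then F i else 0.

Lemma sum_delta m (F : nat -> R) (a : nat) :
  \sum_(j < m) (a == j :> nat)%:R * F j = trunc m F a.
Proof.
rewrite /trunc; case: ltnP => am.
  rewrite (bigD1 (Ordinal am))//=. rewrite eqxx mul1r big1 ?addr0// => i.
  by rewrite -(inj_eq val_inj)/= eq_sym => /negPf ->; rewrite mul0r.
by rewrite big1// => i _; case: eqP => [E|_]; rewrite ?mul0r//; have := ltn_ord i; lia.
Qed.

(** The row [l] may lie outside the matrix: such rows occur once the shift by k enters. *)
Lemma sum_toep m (F : nat -> R) l : let G := trunc m F in
  \sum_(j < m) toep l j * F j =
  G l *+ 6 - (if l is l1.+1 then G l1 else 0) *+ 4 - G l.+1 *+ 4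
  + (if l is l2.+2 then G l2 else 0) + G l.+2.
Proof.
move=> G; transitivity
  ((\sum_(j < m) (l == j :> nat)%:R * F j) *+ 6
   - (\sum_(j < m) (l == j.+1)%:R * F j) *+ 4
   - (\sum_(j < m) (l.+1 == j)%:R * F j) *+ 4
   + (\sum_(j < m) (l == j.+2)%:R * F j)
   + \sum_(j < m) (l.+2 == j)%:R * F j).
  rewrite -!sumrMnl -!sumrB -!big_split /=; apply: eq_bigr => j _.
  by rewrite /toep; ring.
rewrite !sum_delta; congr (_ - _ *+ _ - _ + _ + _).
- case: l => [|l]; first by rewrite big1// => i _; rewrite mul0r.
  by under eq_bigr do rewrite eqSS; rewrite sum_delta.
- case: l => [|[|l]]; [by rewrite big1// => i _; rewrite mul0r..|].
  by under eq_bigr do rewrite !eqSS; rewrite sum_delta.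
Qed.
End Hip.

(** * Cofactors, determinants and the closed form of the terms *)

Section Coef.
Set Implicit Arguments. Unset Strict Implicit. Unset Printing Implicit Defensive.
Variable R : realType.

(* First column of the inverse of [Amx n.+1]; the cubic vanishes at -1, n+1 and n+2. *)
Definition inv_col (n j : nat) : R :=
  j.+1%:R * (n.+1%:R - j%:R) * (n.+2%:R - j%:R) / (n.+3%:R * n.+4%:R).

(** Reversing both indices preserves a symmetric Toeplitz symbol; a shift of the columns thus
    becomes a shift of the rows. *)
Lemma toep_rev n k i j : (i <= n)%N -> (j <= n)%N ->
  toep R i (k + (n - j)) = toep R (k + n - i) j.
Proof.
move=> hi hj; rewrite toepC -(toep_addl _ j) -(toep_addl _ i (k + n - i)).
by congr toep; lia.
Qed.

(** Inside the matrix the stencil is a fourth difference and kills the cubic, except that row 0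
    misses the value -1 taken at index -2, which leaves 1. Rows [n.+1] and [n.+2] meet only the end
    of the column. *)
Lemma sum_toep_inv_col n l : \sum_(j < n.+1) toep R l j * inv_col n j =
  (l == 0%N)%:R - (l == n.+1)%:R * (2 / n.+3%:R)
  + (l == n.+2)%:R * (2 * n.+1%:R / (n.+3%:R * n.+4%:R)).
Proof.
rewrite sum_toep /=; set G := trunc n.+1 (inv_col n).
(* The zeros at [n.+1] and [n.+2] make the truncation invisible up to there. *)
have GE i : (i <= n.+2)%N -> G i = inv_col n i.
  rewrite /G /trunc; case: ltnP => // h1 h2.
  have [->|->] : i = n.+1 \/ i = n.+2 by lia.
    by rewrite /inv_col subrr mulr0 !mul0r.
  by rewrite /inv_col subrr mulr0 !mul0r.
have G0 i : (n.+1 <= i)%N -> G i = 0 by move=> h; rewrite /G /trunc ltnS leqNgt h.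
have n3 : (n.+3%:R : R) != 0 by rewrite pnatr_eq0.
have n4 : (n.+4%:R : R) != 0 by rewrite pnatr_eq0.
have [ln|nl] := leqP l n.
  have -> : (l == n.+1) = false by lia.
  have -> : (l == n.+2) = false by lia.
  by case: l ln => [|[|l]] ln /=; (rewrite !GE; [|lia..]); rewrite /inv_col; field; apply/andP.
have [le|nl1] := eqVneq l n.+1.
  rewrite le (_ : (n.+1 == n.+2) = false); last by lia.
  rewrite [G n.+1]G0 ?[G n.+2]G0 ?[G n.+3]G0; [|lia..].
  case: n {le nl} G GE G0 n3 n4 => [|n] G GE G0 n3 n4 /=; [by rewrite !GE// /inv_col; field|rewrite !GE; [|lia..]].
  by rewrite /inv_col -!natr1 in n3 n4 *; field; apply/andP.
have [le|nl2] := eqVneq l n.+2.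
  rewrite le /= [G n.+1]G0 ?[G n.+2]G0 ?[G n.+3]G0 ?[G n.+4]G0; [|lia..].
  by rewrite GE ?/inv_col; [rewrite ?eqxx; field; apply/andP|lia].
case: l nl nl1 nl2 => [|[|l]] nl nl1 nl2; [lia|lia|].
by rewrite /= !G0; [ring|lia..].
Qed.

(* Cramer's rule without assuming [A] invertible: apply [\adj A] to [A c = e_{i0}]. *)
Lemma cofactor_solve n (A : 'M[R]_n) (i0 : 'I_n) (c : 'I_n -> R) :
  (forall i, \sum_j A i j * c j = (i == i0)%:R) ->
  forall j, cofactor A i0 j = \det A * c j.
Proof.
move=> Ac j; pose u : 'cV[R]_n := \col_j c j.
have : \adj A *m (A *m u) = \det A *: u by rewrite mulmxA mul_adj_mx mul_scalar_mx.
move/matrixP/(_ j 0); rewrite !mxE => <-.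
rewrite (bigD1 i0)//= big1 ?addr0 => [|i ii0]; rewrite !mxE.
  under eq_bigr do rewrite mxE.
  by rewrite Ac eqxx mulr1.
under eq_bigr do rewrite mxE.
by rewrite Ac (negPf ii0) mulr0.
Qed.

Lemma cofactor_ord0 n (j : 'I_n.+1) : cofactor (Amx R n.+1) ord0 j = Dn R n.+1 * inv_col n j.
Proof.
apply: (@cofactor_solve _ _ _ (fun j => inv_col n j)) => i.
under eq_bigr do rewrite AmxE.
rewrite sum_toep_inv_col; have hi := ltn_ord i.
rewrite [(_ == n.+1)]ltn_eqF; last lia.
rewrite [(_ == n.+2)]ltn_eqF; last lia.
by rewrite !mul0r subr0 addr0.
Qed.

(** Reversing the indices fixes the matrix and swaps its first and last rows, so the last inverse
    column is the first one reversed. *)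
Lemma cofactor_ord_max n (j : 'I_n.+1) :
  cofactor (Amx R n.+1) ord_max j = Dn R n.+1 * inv_col n (n - j).
Proof.
apply: (@cofactor_solve _ _ _ (fun j => inv_col n (n - j))) => i.
rewrite (reindex_inj rev_ord_inj)/=.
under eq_bigr => k _.
  have hk : (k <= n)%N by rewrite -ltnS.
  have hi : (i <= n)%N by rewrite -ltnS.
  rewrite AmxE /= subSS -[X in toep _ _ X]add0n toep_rev// subKn// add0n.
  over.
rewrite sum_toep_inv_col; have hi := ltn_ord i.
rewrite [(_ == n.+1)]ltn_eqF; last lia.
rewrite [(_ == n.+2)]ltn_eqF; last lia.
rewrite !mul0r subr0 addr0 subn_eq0 -(inj_eq val_inj)/= eqn_leq.
by rewrite -[(i <= n)%N]ltnS hi.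
Qed.

(** By shift invariance the minor at (0,0) is the matrix one size smaller. Positivity of all the
    determinants follows by induction. *)
Lemma DnS n : Dn R n = Dn R n.+1 * inv_col n 0.
Proof.
rewrite -(cofactor_ord0 ord0) /cofactor expr0 mul1r; congr (\det _).
by apply/matrixP => i j; rewrite AmxE [RHS]mxE [RHS]mxE AmxE -(toep_addl _ 1) !lift0.
Qed.

Lemma inv_col0_gt0 n : 0 < inv_col n 0.
Proof. by rewrite /inv_col !subr0 divr_gt0// ?mulr_gt0. Qed.

Lemma Dn_gt0 n : 0 < Dn R n.
Proof.
elim: n => [|n IH]; first by rewrite /Dn det_mx00.
by move: IH; rewrite DnS pmulr_lgt0// inv_col0_gt0.
Qed.

(** Makes the separate clause for n = 0 in [phi] and [psi] an instance of the general one. *)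
Lemma hip_pp_Dn : hip (pp R) (pp R) = Dn R 1 * Dn R 0.
Proof.
rewrite /Dn det_mx00 mulr1 det_mx11 AmxE.
by have := @hip_pp R 0 0 0 0 erefl; rewrite !expr0 !mulr1.
Qed.

Lemma phiE n : phi R n = rsc (Num.sqrt (Dn R n.+1 * Dn R n))^-1
  (\sum_(j < n.+1) rsc (Dn R n.+1 * inv_col n j) (pp R * zv R ^+ j * wv R ^+ (n - j))).
Proof.
case: n => [|n] /=; last first.
  by congr rsc; apply: eq_bigr => j _; rewrite cofactor_ord0.
rewrite hip_pp_Dn big_ord_recl big_ord0 addr0 -DnS /Dn det_mx00.
by rewrite [in RHS]/rsc !mul1r !expr0 !mulr1.
Qed.

Lemma psiE n : psi R n = rsc (Num.sqrt (Dn R n.+1 * Dn R n))^-1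
  (\sum_(j < n.+1) rsc (Dn R n.+1 * inv_col n (n - j)) (pp R * zv R ^+ j * wv R ^+ (n - j))).
Proof.
case: n => [|n] /=; last first.
  by congr rsc; apply: eq_bigr => j _; rewrite cofactor_ord_max.
rewrite hip_pp_Dn big_ord_recl big_ord0 addr0 -DnS /Dn det_mx00.
by rewrite [in RHS]/rsc !mul1r !expr0 !mulr1.
Qed.

Lemma mul_rsc (c : R) f g : f * rsc c g = rsc c (f * g).
Proof. by rewrite /rsc mulrCA. Qed.

(** The normalizations leave D_{n+1} / D_n, the inverse of [inv_col n 0]. Reversing j undoes the
    reversal in [psi], so the inner sum is row [k + n - i] applied to the inverse column. *)
Lemma hip_phi_psi k n : hip (wv R ^+ k * phi R n) (zv R ^+ k * psi R n) =
  (inv_col n 0)^-1 * \sum_(i < n.+1) inv_col n i * \sum_(j < n.+1) toep R (k + n - i) j * inv_col n j.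
Proof.
have D1 := Dn_gt0 n.+1; have D0 := Dn_gt0 n.
rewrite phiE psiE !mul_rsc hip_rscl hip_rscr mulrA -invfM -expr2 sqr_sqrtr; last first.
  by rewrite mulr_ge0 ?ltW.
rewrite [wv R ^+ k * _]mulr_sumr [zv R ^+ k * _]mulr_sumr hip_suml.
rewrite (_ : \sum_(i < n.+1) _ =
  Dn R n.+1 ^+ 2 * \sum_(i < n.+1) inv_col n i * \sum_(j < n.+1) toep R (k + n - i) j * inv_col n j).
  by rewrite mulrA (DnS n) !invfM -/(Dn R n.+1) expr2; congr (_ * _); field; rewrite !gt_eqF ?inv_col0_gt0.
rewrite mulr_sumr; apply: eq_bigr => i _; rewrite hip_sumr.
rewrite [in RHS](reindex_inj rev_ord_inj) !mulr_sumr /=; apply: eq_bigr => j _.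
have hi : (i <= n)%N by rewrite -ltnS.
have hj : (j <= n)%N by rewrite -ltnS.
rewrite !mul_rsc hip_rscl hip_rscr.
rewrite (_ : wv R ^+ k * _ = pp R * zv R ^+ i * wv R ^+ (k + (n - i))); last by rewrite exprD; ring.
rewrite (_ : zv R ^+ k * _ = pp R * zv R ^+ (k + j) * wv R ^+ (n - j)); last by rewrite exprD; ring.
rewrite hip_pp; last by lia.
by rewrite subSS -toep_rev ?leq_subr// subKn//; ring.
Qed.

Definition hterm (k N : R) : R :=
  2 * (N + 1 - k) * (3 * k * (k - 1) - (N - 1) * (N + 2)) / ((N - 1) * N * (N + 1) * (N + 2)).

(** Only rows 0, n+1 and n+2 contribute, and the row is k+n-i: this keeps i = n for k = 0, i = 0 for
    k = 1, and i = k-1, k-2 for k >= 2. *)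
Lemma Sigma_termE k n :
  Sigma_term R k n = if (k <= n.+2)%N then hterm k%:R n.+2%:R ^+ 2 else 0.
Proof.
rewrite /Sigma_term hip_phi_psi real_normK ?num_real//.
under eq_bigr do rewrite sum_toep_inv_col.
set c := 2 / _; set d := 2 * _ / _.
have n0 : 0 <= n%:R :> R by [].
case: k => [|[|k]].
- rewrite (eq_bigr (fun i : 'I_n.+1 => (n == i)%:R * inv_col n i)) => [|i _].
    rewrite sum_delta /trunc ltnSn leq0n /inv_col /hterm.
    rewrite -!natr1; field.
    by repeat (apply/andP; split); apply: lt0r_neq0; lra.
  have hi : (i <= n)%N by rewrite -ltnS.
  rewrite add0n subn_eq0 (@ltn_eqF _ n.+1) ?(@ltn_eqF _ n.+2); [|lia..].
  rewrite (_ : (n == i) = (n <= i)%N); last by rewrite eqn_leq hi andbT.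
  by rewrite !mul0r subr0 addr0 mulrC.
- rewrite (eq_bigr (fun i : 'I_n.+1 => (0%N == i)%:R * (- c * inv_col n i))) => [|i _].
    rewrite (@sum_delta _ _ (fun i => - c * inv_col n i)) /trunc /= /c /inv_col /hterm.
    rewrite -!natr1; field.
    by repeat (apply/andP; split); apply: lt0r_neq0; lra.
  have hi : (i <= n)%N by rewrite -ltnS.
  rewrite subSn// (@ltn_eqF _ n.+2); [|lia].
  rewrite eqSS (_ : (n - i == n)%N = (0%N == i)); last first.
    by apply/eqP/eqP; lia.
  by rewrite sub0r mul0r addr0; move: (_ == _)%:R => b; ring.
rewrite (eq_bigr (fun i : 'I_n.+1 =>
   (k.+1 == i)%:R * (- c * inv_col n i) + (k == i)%:R * (d * inv_col n i))) => [|i _]; last first.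
  have hi : (i <= n)%N by rewrite -ltnS.
  rewrite !addSn !subSn; [|lia..].
  rewrite !eqSS (_ : ((k + n - i).+1 == n)%N = (k.+1 == i)); last by apply/eqP/eqP; lia.
  rewrite (_ : ((k + n - i) == n)%N = (k == i)); last by apply/eqP/eqP; lia.
  by rewrite sub0r; move: (_ == _)%:R (_ == _)%:R => b1 b2; ring.
rewrite big_split /= (@sum_delta _ _ (fun i => - c * inv_col n i)) (@sum_delta _ _ (fun i => d * inv_col n i)).
rewrite /trunc !ltnS; case: (leqP k n) => kn; last first.
  by rewrite ltnNge ltnW//= addr0 mulr0 expr0n.
(* For [k = n] the index [k.+1] is out of range, but the cubic vanishes there. *)
have -> : (if (k < n)%N then - c * inv_col n k.+1 else 0) = - c * inv_col n k.+1.
  case: ltnP => // nk; have -> : k = n by lia.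
  by rewrite /inv_col subrr mulr0 !mul0r mulr0.
rewrite /c /d /inv_col /hterm; congr (_ ^+ 2).
rewrite -!natr1; field.
by repeat (apply/andP; split); apply: lt0r_neq0; lra.
Qed.
End Coef.

(** * Partial fractions and telescoping of the squared terms *)

Section Asymp.
Set Implicit Arguments. Unset Strict Implicit. Unset Printing Implicit Defensive.
Variable R : realType.
Implicit Types (k N x y : R).

(* [2 * r1 k], [2 * r0 k], [2 * rm1 k], [2 * rm2 k] are the residues of [hterm k]
   at N = 1, 0, -1, -2. *)
Definition r1 k := - (k - 2) * k * (k - 1) / 2.
Definition r0 k := (k - 1) * (3 * k ^+ 2 - 3 * k + 2) / 2.
Definition rm1 k := - k * (3 * k ^+ 2 - 3 * k + 2) / 2.
Definition rm2 k := k * (k - 1) * (k + 1) / 2.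

Definition Acoef k := 4 * (r1 k ^+ 2 + r0 k ^+ 2 + rm1 k ^+ 2 + rm2 k ^+ 2).

(** A product of simple poles at distance d is 1/d times their difference, a sum of d unit
    differences. The coefficients of 1/(N-1) - 1/N, 1/N - 1/(N+1) and 1/(N+1) - 1/(N+2) are
    collected here. *)
Definition e0 k := 2 * r0 k * r1 k + rm1 k * r1 k + 2 / 3 * rm2 k * r1 k.
Definition e1 k := 2 * rm1 k * r0 k + rm1 k * r1 k + rm2 k * r0 k + 2 / 3 * rm2 k * r1 k.
Definition e2 k := 2 * rm2 k * rm1 k + rm2 k * r0 k + 2 / 3 * rm2 k * r1 k.

(** The squared parts record the cost of moving the double poles at 1, -1 and -2 to 0. *)
Definition telescoper k N := 4 * (r1 k ^+ 2 * (N - 1)^-1 ^+ 2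
  - (rm1 k ^+ 2 + rm2 k ^+ 2) * N^-1 ^+ 2 - rm2 k ^+ 2 * (N + 1)^-1 ^+ 2
  + e0 k * (N - 1)^-1 + e1 k * N^-1 + e2 k * (N + 1)^-1).

Lemma hterm_pfrac k N : 1 < N -> hterm k N =
  2 * (r1 k / (N - 1) + r0 k / N + rm1 k / (N + 1) + rm2 k / (N + 2)).
Proof.
move=> N1; rewrite /hterm /r1 /r0 /rm1 /rm2; field.
by repeat (apply/andP; split); apply: lt0r_neq0; lra.
Qed.

Lemma hterm_sqr k N : 1 < N ->
  hterm k N ^+ 2 = Acoef k * N^-1 ^+ 2 + telescoper k N - telescoper k (N + 1).
Proof.
move=> N1; rewrite hterm_pfrac// /Acoef /telescoper /e0 /e1 /e2.
move: (r1 k) (r0 k) (rm1 k) (rm2 k) => a b c d.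
field.
by repeat (apply/andP; split); apply: lt0r_neq0; lra.
Qed.

(** Boundary term at N = k, where the sum starts for k >= 2. The factors of the residues cancel
    every pole; the result is odd in y, while [Acoef] is even. *)
Lemma telescoper_diag k : 1 < k -> let y := k - 2^-1 in
  telescoper k k = - (20 * y ^+ 5 + 64 / 3 * y ^+ 3 + 41 / 12 * y).
Proof.
move=> k1; rewrite /telescoper /e0 /e1 /e2 /r1 /r0 /rm1 /rm2 /=; field.
by repeat (apply/andP; split); apply: lt0r_neq0; lra.
Qed.

Lemma AcoefE k : let y := k - 2^-1 in
  Acoef k = 20 * y ^+ 6 + 23 * y ^+ 4 + 19 / 4 * y ^+ 2 + 17 / 16.
Proof. by rewrite /Acoef /r1 /r0 /rm1 /rm2 /=; field. Qed.

(** * Continued-fraction convergents and their unit differences *)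

Definition q4 y := y ^+ 4 + 13 / 14 * y ^+ 2 + 27 / 560.
Definition q5 y := y ^+ 5 + 35 / 18 * y ^+ 3 + 407 / 1008 * y.
(* Convergents of 1/(y + a_1/(y + a_2/(y + ...))) with a_i = i^4 / (4 (4i^2 - 1)),
   the continued fraction of the trigamma function at y + 1/2. *)
Definition u4 y := (y ^+ 3 + 71 / 84 * y) / q4 y.
Definition u5 y := (y ^+ 4 + 67 / 36 * y ^+ 2 + 256 / 945) / q5 y.

Lemma q4_gt0 y : 0 <= y -> 0 < q4 y.
Proof.
move=> y0; have h2 : 0 <= y ^+ 2 by exact: exprn_ge0.
by have h4 : 0 <= y ^+ 4 by [exact: exprn_ge0]; rewrite /q4; lra.
Qed.

Lemma q5_gt0 y : 0 < y -> 0 < q5 y.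
Proof.
move=> y0; have h3 : 0 < y ^+ 3 by exact: exprn_gt0.
by have h5 : 0 < y ^+ 5 by [exact: exprn_gt0]; rewrite /q5; lra.
Qed.

(** The convergent matches the trigamma recurrence up to a constant numerator, 9 a_1 a_2 a_3 a_4 in
    the notation above. *)
Lemma u4_step N : 1 < N ->
  u4 (N - 2^-1) - u4 (N + 2^-1) = N^-1 ^+ 2 - 144 / 1225 / (N ^+ 2 * q4 (N - 2^-1) * q4 (N + 2^-1)).
Proof.
move=> N1; rewrite /u4 /q4; field.
have p4 : 0 < (N * 2 + 1) ^+ 4 by apply: exprn_gt0; lra.
have p2 : 0 < (N * 2 + 1) ^+ 2 by apply: exprn_gt0; lra.
have m4 : 0 < (N * 2 - 1) ^+ 4 by apply: exprn_gt0; lra.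
have m2 : 0 < (N * 2 - 1) ^+ 2 by apply: exprn_gt0; lra.
by repeat (apply/andP; split); apply: lt0r_neq0; lra.
Qed.

(** The error changes sign with the parity of the convergent; its numerator is now 11 a_1 a_2 a_3
    a_4 a_5. *)
Lemma u5_step N : 1 < N ->
  u5 (N - 2^-1) - u5 (N + 2^-1) = N^-1 ^+ 2 + 100 / 441 / (N ^+ 2 * q5 (N - 2^-1) * q5 (N + 2^-1)).
Proof.
move=> N1; rewrite /u5 /q5; field.
have p5 : 0 < (N * 2 + 1) ^+ 5 by apply: exprn_gt0; lra.
have p3 : 0 < (N * 2 + 1) ^+ 3 by apply: exprn_gt0; lra.
have m5 : 0 < (N * 2 - 1) ^+ 5 by apply: exprn_gt0; lra.
have m3 : 0 < (N * 2 - 1) ^+ 3 by apply: exprn_gt0; lra.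
by repeat (apply/andP; split); apply: lt0r_neq0; lra.
Qed.

Lemma u4_step_le N : 1 < N -> u4 (N - 2^-1) - u4 (N + 2^-1) <= N^-1 ^+ 2.
Proof.
move=> N1; rewrite u4_step; last exact: N1.
have N0 : 0 < N by lra.
have qa : 0 < q4 (N - 2^-1) by apply: q4_gt0; lra.
have qb : 0 < q4 (N + 2^-1) by apply: q4_gt0; lra.
move: (q4 (N - 2^-1)) (q4 (N + 2^-1)) qa qb => a b a0 b0.
have : 0 < (N ^+ 2 * a * b)^-1.
  by rewrite invr_gt0; apply: (mulr_gt0 (mulr_gt0 (exprn_gt0 _ N0) a0) b0).
by move: (_ ^-1) (N^-1 ^+ 2) => c d c0; lra.
Qed.

Lemma u5_step_ge N : 1 < N -> N^-1 ^+ 2 <= u5 (N - 2^-1) - u5 (N + 2^-1).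
Proof.
move=> N1; rewrite u5_step; last exact: N1.
have N0 : 0 < N by lra.
have qa : 0 < q5 (N - 2^-1) by apply: q5_gt0; lra.
have qb : 0 < q5 (N + 2^-1) by apply: q5_gt0; lra.
move: (q5 (N - 2^-1)) (q5 (N + 2^-1)) qa qb => a b a0 b0.
have : 0 < (N ^+ 2 * a * b)^-1.
  by rewrite invr_gt0; apply: (mulr_gt0 (mulr_gt0 (exprn_gt0 _ N0) a0) b0).
by move: (_ ^-1) (N^-1 ^+ 2) => c d c0; lra.
Qed.

Lemma frac_bound (y a q : R) : 0 < y -> 0 < q -> 0 <= a -> y * a <= q ->
  0 <= a / q <= y^-1.
Proof.
move=> y0 q0 a0 h; rewrite divr_ge0 ?(ltW q0)//=.
by rewrite ler_pdivrMr// -(ler_pM2l y0) mulrA mulfV ?gt_eqF// mul1r.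
Qed.

(** This crude bound serves to make the corrections tend to 0. *)
Lemma u4_bound y : 0 < y -> 0 <= u4 y <= y^-1.
Proof.
move=> y0; have y2 : 0 <= y ^+ 2 by exact: exprn_ge0 (ltW y0).
have y3 : 0 <= y ^+ 3 by exact: exprn_ge0 (ltW y0).
apply: frac_bound; [exact: y0|exact/q4_gt0/ltW|lra|rewrite /q4; lra].
Qed.

Lemma u5_bound y : 0 < y -> 0 <= u5 y <= y^-1.
Proof.
move=> y0; have y2 : 0 <= y ^+ 2 by exact: exprn_ge0 (ltW y0).
have y3 : 0 <= y ^+ 3 by exact: exprn_ge0 (ltW y0).
have y4 : 0 <= y ^+ 4 by exact: exprn_ge0 (ltW y0).
apply: frac_bound; [exact: y0|exact: q5_gt0|lra|rewrite /q5; lra].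
Qed.

End Asymp.

(** * Two-sided bounds for the tail of zeta(2) *)

Section Series.
Local Open Scope classical_set_scope.
Set Implicit Arguments. Unset Strict Implicit. Unset Printing Implicit Defensive.
Variable R : realType.
Implicit Types (k N x y : R).

(** The sum starts at N = 2, so that [zeta2_tail n] starts at N = n + 2. *)
Definition zeta2_sum : nat -> R := series (fun i => (i.+2%:R)^-1 ^+ 2).

Lemma zeta2_sumS n : zeta2_sum n.+1 = zeta2_sum n + (n.+2%:R)^-1 ^+ 2.
Proof. by rewrite /zeta2_sum !seriesEnat /= big_nat_recr. Qed.

Lemma half_shift_gt0 n : 0 < n.+2%:R - 2^-1 :> R.
Proof. by rewrite subr_gt0; apply: (lt_le_trans (y := 1)); [lra|rewrite ler1n]. Qed.

Lemma cvg_u (u : R -> R) : (forall y, 0 < y -> 0 <= u y <= y^-1) ->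
  u (n.+2%:R - 2^-1) @[n --> \oo] --> 0.
Proof.
move=> hu; apply: (@squeeze_cvgr _ _ _ _ (fun=> 0) (@harmonic R)).
- near=> n; have /andP[-> h] := hu _ (half_shift_gt0 n) => /=.
  rewrite (le_trans h)// /harmonic lef_pV2 ?posrE ?half_shift_gt0// -[n.+2%:R]natr1; lra.
- exact: cvg_cst.
- exact: cvg_harmonic.
Unshelve. all: by end_near. Qed.

Lemma shift_half n : n.+3%:R - 2^-1 = n.+2%:R + 2^-1 :> R.
Proof. by rewrite -[n.+3%:R]natr1; lra. Qed.

(** The corrections vanish at infinity, so the corrected sums keep the limit of [zeta2_sum], and
    their monotonicity traps the tail between [u4] and [u5]. *)
Lemma zeta2_sum_u4_incr : nondecreasing_seq (fun n => zeta2_sum n + u4 (n.+2%:R - 2^-1)).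
Proof.
apply/nondecreasing_seqP => n; rewrite zeta2_sumS shift_half.
have n1 : 1 < n.+2%:R :> R by rewrite ltr1n.
have := u4_step_le n1; move: (_^-1 ^+ 2) (u4 _) (u4 _) => a b c h; lra.
Qed.

Lemma zeta2_sum_u5_decr : nonincreasing_seq (fun n => zeta2_sum n + u5 (n.+2%:R - 2^-1)).
Proof.
apply/nonincreasing_seqP => n; rewrite zeta2_sumS shift_half.
have n1 : 1 < n.+2%:R :> R by rewrite ltr1n.
have := u5_step_ge n1; move: (_^-1 ^+ 2) (u5 _) (u5 _) => a b c h; lra.
Qed.

Lemma zeta2_sum_cvg : cvgn zeta2_sum.
Proof.
apply: nondecreasing_is_cvgn.
  by apply/nondecreasing_seqP => n; rewrite zeta2_sumS lerDl exprn_ge0 ?invr_ge0.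
exists (zeta2_sum 0 + u5 (2%:R - 2^-1)) => _ [n _ <-].
apply: le_trans (zeta2_sum_u5_decr (leq0n n)).
by rewrite lerDl; have /andP[] := u5_bound (half_shift_gt0 n).
Qed.

Definition zeta2_tail n := limn zeta2_sum - zeta2_sum n.

Lemma zeta2_tailS n : zeta2_tail n.+1 = zeta2_tail n - (n.+2%:R)^-1 ^+ 2.
Proof. by rewrite /zeta2_tail zeta2_sumS opprD addrA. Qed.

Lemma zeta2_tail_ge n : u4 (n.+2%:R - 2^-1) <= zeta2_tail n.
Proof.
have h : zeta2_sum n + u4 (n.+2%:R - 2^-1) @[n --> \oo] --> limn zeta2_sum.
  by rewrite -[limn zeta2_sum]addr0; apply: cvgD; [exact: zeta2_sum_cvg|exact: (@cvg_u _ (@u4_bound R))].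
have := nondecreasing_cvgn_le zeta2_sum_u4_incr (cvgP _ h) n.
by rewrite (cvg_lim _ h)// /zeta2_tail; lra.
Qed.

Lemma zeta2_tail_le n : zeta2_tail n <= u5 (n.+2%:R - 2^-1).
Proof.
have h : zeta2_sum n + u5 (n.+2%:R - 2^-1) @[n --> \oo] --> limn zeta2_sum.
  by rewrite -[limn zeta2_sum]addr0; apply: cvgD; [exact: zeta2_sum_cvg|exact: (@cvg_u _ (@u5_bound R))].
have := nonincreasing_cvgn_ge zeta2_sum_u5_decr (cvgP _ h) n.
by rewrite (cvg_lim _ h)// /zeta2_tail; lra.
Qed.

Lemma cvg_inv_shift c : (n + c.+1)%:R^-1 @[n --> \oo] --> (0 : R).
Proof.
rewrite (_ : (fun n => _) = (fun n => @harmonic R (n + c)%N)); last first.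
  by apply/funext => n; rewrite addnS.
by rewrite (cvg_shiftn c (@harmonic R)); exact: cvg_harmonic.
Qed.

Lemma cvg_telescoper k : telescoper k n.+2%:R @[n --> \oo] --> 0.
Proof.
have h i := cvg_inv_shift i.
rewrite /telescoper (_ : 0 = 4 * (r1 k ^+ 2 * 0 ^+ 2 - (rm1 k ^+ 2 + rm2 k ^+ 2) * 0 ^+ 2
  - rm2 k ^+ 2 * 0 ^+ 2 + e0 k * 0 + e1 k * 0 + e2 k * 0)); last by ring.
have c0 : (n.+2%:R - 1 : R)^-1 @[n --> \oo] --> (0 : R).
  rewrite (_ : (fun n => _) = (fun n => (n + 1)%:R^-1)); first exact: h.
  by apply/funext => n; rewrite -natr1 addrK addn1.
have c1 : (n.+2%:R : R)^-1 @[n --> \oo] --> (0 : R).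
  rewrite (_ : (fun n => _) = (fun n => (n + 2)%:R^-1)); first exact: h.
  by apply/funext => n; rewrite addn2.
have c2 : (n.+2%:R + 1 : R)^-1 @[n --> \oo] --> (0 : R).
  rewrite (_ : (fun n => _) = (fun n => (n + 3)%:R^-1)); first exact: h.
  by apply/funext => n; rewrite natr1 addn3.
have sq (f : nat -> R) : f n @[n --> \oo] --> (0 : R) -> f n ^+ 2 @[n --> \oo] --> (0 ^+ 2 : R).
  by move=> hf; rewrite !expr2; under eq_cvg do rewrite expr2; exact: cvgM.
have mc (c : R) (f : nat -> R) (l : R) : f n @[n --> \oo] --> l -> c * f n @[n --> \oo] --> c * l.
  by move=> hf; apply: cvgM hf; exact: cvg_cst.
apply: (mc 4); do 3 (apply: cvgD; last exact: mc).
apply: cvgB; last by apply: mc; apply: sq.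
apply: cvgB; last by apply: mc; apply: sq.
by apply: mc; apply: sq.
Qed.
End Series.

(** * Value, monotonicity and expansion of Sigma_k *)

Section SigmaValue.
Set Implicit Arguments. Unset Strict Implicit. Unset Printing Implicit Defensive.
Local Open Scope classical_set_scope.
Variable R : realType.
Implicit Types (x y : R).

(** [s] is the first n with k <= n + 2, as truncated subtraction also gives 0 for k = 0, 1; earlier
    terms vanish. *)
Lemma series_SigmaE k m : let s := (k - 2)%N in
  series (Sigma_term R k) (m + s)%N = Acoef k%:R * (zeta2_sum R (m + s) - zeta2_sum R s)
    + telescoper k%:R s.+2%:R - telescoper k%:R (m + s).+2%:R.
Proof.
move=> s; elim: m => [|m IH].
  rewrite !add0n subrr mulr0 add0r subrr /series /= big_nat big1// => i /andP[_ hi].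
  by rewrite Sigma_termE; case: leqP => // h; move: hi; rewrite /s; lia.
rewrite addSn [LHS](_ : _ = series (Sigma_term R k) (m + s)%N + Sigma_term R k (m + s)%N); last first.
  by rewrite !seriesEnat /= big_nat_recr.
rewrite IH Sigma_termE.
have -> : (k <= (m + s).+2)%N by rewrite /s; lia.
rewrite hterm_sqr ?ltr1n// natr1 zeta2_sumS; ring.
Qed.

Lemma series_Sigma_cvg k : series (Sigma_term R k) @ \oo -->
  Acoef k%:R * zeta2_tail R (k - 2) + telescoper k%:R (k - 2).+2%:R.
Proof.
set s := (k - 2)%N; rewrite -(cvg_shiftn s).
pose f n : R := Acoef k%:R * (zeta2_sum R n - zeta2_sum R s) + telescoper k%:R s.+2%:R - telescoper k%:R n.+2%:R.
rewrite (_ : (fun n => _) = (fun n => f (n + s)%N)); last first.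
  by apply/funext => n; exact: series_SigmaE.
rewrite (cvg_shiftn s f) -[Acoef _ * zeta2_tail _ _ + _]subr0.
apply: cvgB; last exact: cvg_telescoper.
apply: cvgD; last exact: cvg_cst.
apply: cvgM; first exact: cvg_cst.
by apply: cvgB; [exact: zeta2_sum_cvg|exact: cvg_cst].
Qed.

Lemma SigmaE k : Sigma R k = Acoef k%:R * zeta2_tail R (k - 2) + telescoper k%:R (k - 2).+2%:R.
Proof. by rewrite /Sigma (cvg_lim _ (@series_Sigma_cvg k)). Qed.

(** The left side is Sigma_k - Sigma_{k+1} with the tail replaced by [u5]: a lower bound, since
    [Acoef] increases. Expanding at x = k - 2 makes all numerator coefficients positive. *)
Lemma drop_formula x : 0 <= x -> let k := x + 2 in
  (Acoef k - Acoef (k + 1)) * u5 (k - 2^-1) + Acoef (k + 1) * k^-1 ^+ 2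
    + telescoper k k - telescoper (k + 1) (k + 1) =
  (92 / 105 * x ^+ 5 + 46 / 7 * x ^+ 4 + 4192 / 189 * x ^+ 3 + 838 / 21 * x ^+ 2
    + 2068 / 63 * x + 4216 / 945) / (k ^+ 2 * q5 (k - 2^-1)).
Proof.
move=> x0 k; rewrite !telescoper_diag; [|rewrite /k; lra..].
rewrite !AcoefE /u5 /q5 /k /=; field.
have h5 : 0 < ((x + 2) * 2 - 1) ^+ 5 by apply: exprn_gt0; lra.
have h3 : 0 < ((x + 2) * 2 - 1) ^+ 3 by apply: exprn_gt0; lra.
by apply/andP; split; apply: lt0r_neq0; lra.
Qed.

(** Lower margin in the expansion, again with positive coefficients, some written as mixed numbers.
    As [u5] - [u4] has order y^-9 and [Acoef] degree 6, these convergents determine Sigma_k up to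
    order k^-3. *)
Lemma low_formula x : 0 <= x -> let k := x + 2 in
  k^-1 ^+ 3 + (Acoef k * u4 (k - 2^-1) + telescoper k k - (92 / (105 * k) + 46 / (105 * k ^+ 2))) =
  (279 / 245 * x ^+ 4 + (6 + 604 / 735) * x ^+ 3 + (16 + 1301 / (15 * 245)) * x ^+ 2 + (18 + 1532 / (15 * 245)) * x
    + 284 / 35) / (k ^+ 3 * q4 (k - 2^-1)).
Proof.
move=> x0 k; rewrite !telescoper_diag; [|rewrite /k; lra..].
rewrite !AcoefE /u4 /q4 /k /=; field.
have h4 : 0 < ((x + 2) * 2 - 1) ^+ 4 by apply: exprn_gt0; lra.
have h2 : 0 < ((x + 2) * 2 - 1) ^+ 2 by apply: exprn_gt0; lra.
by apply/andP; split; apply: lt0r_neq0; lra.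
Qed.

Lemma up_formula x : 0 <= x -> let k := x + 2 in
  k^-1 ^+ 3 - (Acoef k * u5 (k - 2^-1) + telescoper k k - (92 / (105 * k) + 46 / (105 * k ^+ 2))) =
  (3 / 5 * x ^+ 5 + 173 / 42 * x ^+ 4 + (12 + 1462 / (9 * 245)) * x ^+ 3 + (21 + 6481 / (14 * 945)) * x ^+ 2
    + (19 + 1030 / (7 * 189)) * x + (7 + 681 / 945 + 2 / (7 * 945))) / (k ^+ 3 * q5 (k - 2^-1)).
Proof.
move=> x0 k; rewrite !telescoper_diag; [|rewrite /k; lra..].
rewrite !AcoefE /u5 /q5 /k /=; field.
have h5 : 0 < ((x + 2) * 2 - 1) ^+ 5 by apply: exprn_gt0; lra.
have h3 : 0 < ((x + 2) * 2 - 1) ^+ 3 by apply: exprn_gt0; lra.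
by apply/andP; split; apply: lt0r_neq0; lra.
Qed.

Lemma Acoef_incr y : 1 < y -> Acoef y <= Acoef (y + 1).
Proof.
move=> y1; rewrite !AcoefE; set z := y - 2^-1.
have -> : y + 1 - 2^-1 = z + 1 by rewrite /z; ring.
have z0 : 0 <= z by rewrite /z; lra.
clearbody z; have z2 : 0 <= z ^+ 2 by exact: exprn_ge0.
have z3 : 0 <= z ^+ 3 by exact: exprn_ge0.
have z4 : 0 <= z ^+ 4 by exact: exprn_ge0.
have z5 : 0 <= z ^+ 5 by exact: exprn_ge0.
by lra.
Qed.

Lemma Sigma2_lt n : Sigma R n.+3 < Sigma R n.+2.
Proof.
rewrite !SigmaE !subSS !subn0 zeta2_tailS -[n.+3%:R]natr1 -[n.+2]addn2 natrD.
set x : R := n%:R; have x0 : 0 <= x by rewrite /x.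
have := zeta2_tail_le R n; rewrite -[n.+2]addn2 natrD -/x => hT.
have k1 : 1 < x + 2 by lra.
have k0 : 0 < x + 2 by lra.
have y0 : 0 < x + 2 - 2^-1 by lra.
have := drop_formula x0; have := Acoef_incr k1; move: hT => /=.
set k := x + 2; move: (zeta2_tail R n) (u5 _) (Acoef k) (Acoef (k + 1)) => t u a b hT hab e.
have : 0 < (92 / 105 * x ^+ 5 + 46 / 7 * x ^+ 4 + 4192 / 189 * x ^+ 3 + 838 / 21 * x ^+ 2
    + 2068 / 63 * x + 4216 / 945) / (k ^+ 2 * q5 (k - 2^-1)).
  clear e; apply: divr_gt0; last by apply: mulr_gt0; [exact: exprn_gt0|exact: q5_gt0].
  have x2 : 0 <= x ^+ 2 by exact: exprn_ge0.
  have x3 : 0 <= x ^+ 3 by exact: exprn_ge0.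
  have x4 : 0 <= x ^+ 4 by exact: exprn_ge0.
  have x5 : 0 <= x ^+ 5 by exact: exprn_ge0.
  by lra.
rewrite -{}e; move: (telescoper k k) (telescoper _ _) (k^-1 ^+ 2) => r s v.
(* This product is the loss from replacing the tail [t] by its upper bound [u]. *)
have : 0 <= (b - a) * (u - t) by apply: mulr_ge0; lra.
by lra.
Qed.

Lemma Sigma_lt n : Sigma R n.+1 < Sigma R n.
Proof.
case: n => [|[|n]]; last exact: Sigma2_lt.
  (* [Acoef] is 4 at both k = 0 and k = 1, so only the telescopers 0 and -1 differ. *)
  rewrite !SigmaE !sub0n.
  rewrite (_ : telescoper 0 2 = 0); last by rewrite /telescoper /e0 /e1 /e2 /r1 /r0 /rm1 /rm2; field.
  rewrite (_ : telescoper 1 2 = -1); last by rewrite /telescoper /e0 /e1 /e2 /r1 /r0 /rm1 /rm2; field.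
  by rewrite /Acoef /r1 /r0 /rm1 /rm2; move: (zeta2_tail R 0) => t; lra.
rewrite !SigmaE !subSS !sub0n telescoper_diag; last by lra.
rewrite (_ : telescoper 1 2 = -1); last by rewrite /telescoper /e0 /e1 /e2 /r1 /r0 /rm1 /rm2; field.
(* With t the tail, the claim is 356 t - 229 < 4 t - 1, that is t < 228/352, and 647/1000 lies just
   below this. *)
have hu : u5 (2 - 2^-1) <= 647 / 1000 :> R.
  by rewrite /u5 ler_pdivrMr; [rewrite /q5; lra|apply: q5_gt0; lra].
have := le_trans (zeta2_tail_le R 0) hu.
by rewrite /Acoef /r1 /r0 /rm1 /rm2; move: (zeta2_tail R 0) => t; lra.
Qed.

Lemma Sigma_asymp n : let k : R := n.+2%:R in
  `|Sigma R n.+2 - (92 / (105 * k) + 46 / (105 * k ^+ 2))| <= k^-1 ^+ 3.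
Proof.
rewrite SigmaE !subSS !subn0 -[n.+2]addn2 natrD.
set x : R := n%:R; have x0 : 0 <= x by rewrite /x.
have := zeta2_tail_le R n; have := zeta2_tail_ge R n; rewrite -[n.+2]addn2 natrD -/x => hl hu.
have k0 : 0 < x + 2 by lra.
have y0 : 0 < x + 2 - 2^-1 by lra.
have A0 : 0 <= Acoef (x + 2).
  by rewrite /Acoef; apply: mulr_ge0; [lra|rewrite !addr_ge0 ?sqr_ge0].
have x2 : 0 <= x ^+ 2 by exact: exprn_ge0.
have x3 : 0 <= x ^+ 3 by exact: exprn_ge0.
have x4 : 0 <= x ^+ 4 by exact: exprn_ge0.
have x5 : 0 <= x ^+ 5 by exact: exprn_ge0.
have L0 : 0 <= (279 / 245 * x ^+ 4 + (6 + 604 / 735) * x ^+ 3 + (16 + 1301 / (15 * 245)) * x ^+ 2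
    + (18 + 1532 / (15 * 245)) * x + 284 / 35) / ((x + 2) ^+ 3 * q4 (x + 2 - 2^-1)).
  apply: divr_ge0; first by clear hl hu; lra.
  by apply: mulr_ge0; [apply: exprn_ge0|]; apply: ltW; [exact: k0|apply: q4_gt0; exact: ltW].
have U0 : 0 <= (3 / 5 * x ^+ 5 + 173 / 42 * x ^+ 4 + (12 + 1462 / (9 * 245)) * x ^+ 3
    + (21 + 6481 / (14 * 945)) * x ^+ 2 + (19 + 1030 / (7 * 189)) * x
    + (7 + 681 / 945 + 2 / (7 * 945))) / ((x + 2) ^+ 3 * q5 (x + 2 - 2^-1)).
  apply: divr_ge0; first by clear hl hu L0; lra.
  by apply: mulr_ge0; [apply: exprn_ge0|]; apply: ltW; [exact: k0|exact: q5_gt0].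
(* Scaling the tail bounds by [Acoef] >= 0 turns the two margins into the two sides of the absolute
   value. *)
move: L0 U0 (ler_wpM2l A0 hl) (ler_wpM2l A0 hu); rewrite -(low_formula x0) -(up_formula x0) /=; clear.
rewrite ler_norml; set k := x + 2.
move: (Acoef k * u4 _) (Acoef k * u5 _) (Acoef k * zeta2_tail R n) (telescoper k k) (92 / _ + _) (_ ^+ 3) => l u a r m c.
by move=> *; apply/andP; split; lra.
Qed.
End SigmaValue.

Theorem theorem3p5 (R : realType) :
  (forall k : nat, cvgn (series (Sigma_term R k))) /\
  (forall k : nat, Sigma R k.+1 < Sigma R k) /\
  (exists (C : R) (K : nat), forall k : nat, (K <= k)%N ->
     `| Sigma R k - (92 / (105 * k%:R) + 46 / (105 * k%:R ^+ 2)) |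
       <= C / k%:R ^+ 3).
Proof.
split; first by move=> k; apply: cvgP (@series_Sigma_cvg R k).
split; first exact: Sigma_lt.
exists 1, 2%N => -[|[|n]]// _; rewrite div1r -exprVn; exact: Sigma_asymp.
Qed.
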